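(* Let $X$ be a finite set with $|X|\ge 2$ and let $\mathbb{M}_X$ be the free monoid with basis $X$. The basis $X$ consists of all irreducible elements of $\mathbb{M}_X$ and is definable without parameters in $\mathbb{M}_X$; thus the set of primitive elements of $\mathbb{M}_X$ and, therefore, the set of free bases of $\mathbb{M}_X$ (as a set of $|X|$-tuples) are definable in $\mathbb{M}_X$.
   Context: A subset $A\subseteq\mathbb{M}_X^n$ is definable in $\mathbb{M}_X$ if it is the solution set of a first-order formula in the language of monoids. A non-trivial element of a monoid is irreducible if it is not a product of two non-trivial elements. An element is primitive if it belongs to some free basis of $\mathbb{M}_X$. *)

(* Defs.v *)
From HB Require Import structures.
From mathcomp Require Import all_boot.

Set Implicit Arguments.
Unset Strict Implicit.
Unset Printing Implicit Defensive.

Local Open Scope group_scope.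

(* First-order logic over the language of monoids (1 and binary product).
   Formulas are well-scoped: [formula n] is the type of formulas whose free
   variables are among n variables, and no element of a monoid occurs in them,
   so [definable] below is definability without parameters. *)

Inductive term (n : nat) : Type :=
| Var of 'I_n
| One
| Mul of term n & term n.

Inductive formula : nat -> Type :=
| Eq n of term n & term n : formula n
| Neg n of formula n : formula n
| And n of formula n & formula n : formula n
| Or n of formula n & formula n : formula n
| Imp n of formula n & formula n : formula n
| All n of formula n.+1 : formula n
| Ex n of formula n.+1 : formula n.

Fixpoint eval (M : monoidType) n (v : n.-tuple M) (t : term n) : M :=
  match t with
  | Var i => tnth v i
  | One => 1
  | Mul t1 t2 => eval v t1 * eval v t2
  end.

(* A quantifier binds variable 0 and shifts the variables already in scope. *)
Fixpoint sat (M : monoidType) n (f : formula n) : n.-tuple M -> Prop :=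
  match f in formula k return k.-tuple M -> Prop with
  | Eq _ t1 t2 => fun v => eval v t1 = eval v t2
  | Neg _ g => fun v => ~ sat g v
  | And _ g h => fun v => sat g v /\ sat h v
  | Or _ g h => fun v => sat g v \/ sat h v
  | Imp _ g h => fun v => sat g v -> sat h v
  | All _ g => fun v => forall x : M, sat g [tuple of x :: v]
  | Ex _ g => fun v => exists x : M, sat g [tuple of x :: v]
  end.

Definition definable (M : monoidType) n (A : n.-tuple M -> Prop) : Prop :=
  exists f : formula n, forall v : n.-tuple M, A v <-> sat f v.

(* Subsets of M are identified with sets of 1-tuples. *)
Definition definable1 (M : monoidType) (A : M -> Prop) : Prop :=
  definable (fun v : 1.-tuple M => A (thead v)).

Definition irreducible (M : monoidType) (x : M) : Prop :=
  x <> 1 /\ ~ (exists y z : M, [/\ y <> 1, z <> 1 & x = y * z]).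

(* B is a free basis of M: every element of M is, in a unique way, the product
   of a finite sequence of elements of B (the empty sequence has product 1).
   Equivalently, the canonical morphism from words over B to M is bijective. *)
Definition free_basis (M : monoidType) (B : M -> Prop) : Prop :=
  forall m : M, exists! w : seq M,
    (forall b, b \in w -> B b) /\ \prod_(b <- w) b = m.

Definition primitive (M : monoidType) (x : M) : Prop :=
  exists B : M -> Prop, free_basis B /\ B x.

Definition free_basis_tuple (M : monoidType) n (t : n.-tuple M) : Prop :=
  uniq t /\ free_basis (fun x => x \in t).

Definition free_monoid (X : Type) : Type := seq X.

Section FreeMonoid.

Variable X : choiceType.

HB.instance Definition _ := Choice.copy (free_monoid X) (seq X).
HB.instance Definition _ :=
  isMonoid.Build (free_monoid X) (@catA X) (@cat0s X) (@cats0 X).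

(* The embedding of the alphabet X in the free monoid. *)
Definition letter (x : X) : free_monoid X := [:: x].

Definition basis (m : free_monoid X) : Prop := exists x : X, m = letter x.

Lemma basis_free : free_basis basis.
Proof.
have prodE (s : seq X) : \prod_(b <- map letter s) b = s :> free_monoid X.
  by elim: s => [|x s IHs]; rewrite ?big_nil //= big_cons IHs.
move=> m; exists (map letter m); split.
  by split=> [b /mapP[x _ ->]|]; [exists x | exact: prodE].
move=> w [wB <-].
suff [s ->] : exists s, w = map letter s by rewrite prodE.
elim: w wB => [|b w IHw] wB; first by exists [::].
have [x ->] := wB b (mem_head b w).
have [|s ->] := IHw; first by move=> c cw; apply: wB; rewrite inE cw orbT.
by exists (x :: s).
Qed.

End FreeMonoid.

(* Main.v *)
Require Import Defs.
From mathcomp Require Import all_boot.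

Set Implicit Arguments.
Unset Strict Implicit.
Unset Printing Implicit Defensive.

(* In any monoid with a free basis B, uniqueness of factorizations over B forces
   B to be exactly the set of irreducible elements, so the free basis is unique
   and "irreducible" is visibly a first-order property. Free bases, listed as
   tuples of length #|X|, are then the tuples of distinct irreducible elements,
   because there are exactly #|X| of these. *)

Lemma free_basis_irreducible (M : monoidType) (B : M -> Prop) :
  free_basis B -> forall x : M, B x <-> irreducible x.
Proof.
move=> freeB.
have fact_inj (w1 w2 : seq M) :
    (forall b, b \in w1 -> B b) -> (forall b, b \in w2 -> B b) ->
    (\prod_(b <- w1) b = \prod_(b <- w2) b)%g -> w1 = w2.
  move=> Bw1 Bw2 eq12; have [w [_ w_uniq]] := freeB (\prod_(b <- w2) b)%g.
  by rewrite -(w_uniq w1) // -(w_uniq w2).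
have B1seq b : B b -> forall c, c \in [:: b] -> B c.
  by move=> Bb c; rewrite inE => /eqP->.
have B_neq1 b : B b -> b <> 1%g.
  (* If [b] were trivial, [[:: b]] and the empty word would be two factorizations of 1. *)
  move=> Bb b1; suff: [:: b] = [::] by [].
  by apply: fact_inj => //; [exact: B1seq | rewrite big_seq1 big_nil].
move=> x; split=> [Bx | [x_neq1 x_irr]].
  split=> [|[y [z [y_neq1 z_neq1 x_yz]]]]; first exact: B_neq1.
  have [wy [[Bwy def_y] _]] := freeB y; have [wz [[Bwz def_z] _]] := freeB z.
  (* Factorizations of [y] and [z] concatenate to one of [x], which can only be [[:: x]]; by length,
     [wy] or [wz] is empty, so [y] or [z] is trivial. *)
  have wyz : wy ++ wz = [:: x].
    apply: fact_inj; last by rewrite big_cat big_seq1 /= def_y def_z.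
      by move=> b; rewrite mem_cat => /orP[/Bwy|/Bwz].
    exact: B1seq.
  case: wy wz def_y def_z wyz {Bwy Bwz} => [|a wy] [|b wz] //=.
  - by move=> def_y; case: y_neq1; rewrite -def_y big_nil.
  - by move=> _ def_z; case: z_neq1; rewrite -def_z big_nil.
  by case: wy.
(* The length of the factorization of [x] decides: length 0 makes [x] trivial, length 1 puts [x] in
   [B], and a longer word splits off its first factor, against irreducibility. *)
have [[|b [|c w]] [[Bw def_x] _]] := freeB x.
- by case: x_neq1; rewrite -def_x big_nil.
- by rewrite -def_x big_seq1; apply: Bw; rewrite mem_head.
case: x_irr; exists b, (\prod_(d <- c :: w) d)%g; split.
- by apply: B_neq1; apply: Bw; rewrite mem_head.
- move=> w1; suff: c :: w = [::] by [].
  apply: fact_inj => //; last by rewrite w1 big_nil.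
  by move=> d dw; apply: Bw; rewrite inE dw orbT.
by rewrite -def_x big_cons.
Qed.

(** Equivalent predicates need not be equal, so freeness has to be transported explicitly, from the
    letters to the entries of a tuple. *)
Lemma free_basis_ext (M : monoidType) (B C : M -> Prop) :
  (forall x, B x <-> C x) -> free_basis B -> free_basis C.
Proof.
move=> BC freeB m; have [w [[Bw prod_w] w_uniq]] := freeB m.
exists w; split=> [|w' [Cw' prod_w']]; first by split=> // b /Bw/BC.
by apply: w_uniq; split=> // b /Cw'/BC.
Qed.

Lemma definable_iff (M : monoidType) n (A B : n.-tuple M -> Prop) :
  (forall v, A v <-> B v) -> definable B -> definable A.
Proof. by move=> AB [f defB]; exists f => v; split=> [/AB/defB | /defB/AB]. Qed.

Lemma definable_and (M : monoidType) n (A B : n.-tuple M -> Prop) :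
  definable A -> definable B -> definable (fun v => A v /\ B v).
Proof.
by move=> [f defA] [g defB]; exists (And f g) => v /=; split=> -[/defA ? /defB].
Qed.

(** The guard [b] does not depend on [v], so it selects the formula from outside the language: a
    false guard yields the valid equation 1 = 1. *)
Lemma definable_imp (M : monoidType) n (b : bool) (A : n.-tuple M -> Prop) :
  definable A -> definable (fun v => b -> A v).
Proof.
case: b => [|_]; first by apply: definable_iff => v; split=> [|Av _]; first exact.
by exists (Eq (One n) (One n)).
Qed.

(** The index type is finite, so this is a finite conjunction built along [enum I], not a quantifier
    of the language; the empty conjunction is 1 = 1. *)
Lemma definable_forall (M : monoidType) n (I : finType)
    (A : I -> n.-tuple M -> Prop) :
  (forall i, definable (A i)) -> definable (fun v => forall i, A i v).
Proof.
move=> defA.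
suff: definable (fun v => forall i, i \in enum I -> A i v).
  by apply: definable_iff => v; split=> Av i => [_|]; last apply: Av; rewrite ?mem_enum.
elim: (enum I) => [|i s IHs]; first by exists (Eq (One n) (One n)).
apply: definable_iff (definable_and (defA i) IHs) => v; split.
  by move=> Av; split=> [|j js]; apply: Av; rewrite inE ?eqxx ?js ?orbT.
by move=> [Ai As] j; rewrite inE => /predU1P[->|/As].
Qed.

Lemma definable_neq (M : monoidType) n (i j : 'I_n) :
  definable (fun v : n.-tuple M => tnth v i <> tnth v j).
Proof. by exists (Neg (Eq (Var i) (Var j))). Qed.

Lemma definable_uniq (M : monoidType) n :
  definable (fun v : n.-tuple M => uniq v).
Proof.
(* Distinctness becomes a conjunction of inequations over pairs of positions, with [i != j] as an
   external guard. *)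
apply: (@definable_iff _ _ _
  (fun v => forall i j : 'I_n, i != j -> tnth v i <> tnth v j)); last first.
  by do 2 apply: definable_forall => ?; apply/definable_imp/definable_neq.
move=> v; split=> [/tuple_uniqP v_inj i j /eqP neq_ij /v_inj // | v_inj].
by apply/tuple_uniqP => i j eq_ij; apply/eqP/negPn/negP => /v_inj.
Qed.

Lemma definable_irreducible (M : monoidType) n (i : 'I_n) :
  definable (fun v : n.-tuple M => irreducible (tnth v i)).
Proof.
(* Under two quantifiers index [i] moves up by two; the outer witness [y] has index 1 and the inner
   witness [z] index 0. *)
pose x : 'I_n.+2 := lift ord0 (lift ord0 i).
pose y : 'I_n.+2 := lift ord0 ord0.
pose z : 'I_n.+2 := ord0.
exists (And (Neg (Eq (Var i) (One n)))
  (Neg (Ex (Ex (And (Neg (Eq (Var y) (One _)))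
    (And (Neg (Eq (Var z) (One _))) (Eq (Var x) (Mul (Var y) (Var z))))))))).
move=> v /=; rewrite /irreducible; split=> -[x_neq1 x_irr]; split=> //.
  move=> [a [b]]; rewrite !tnthS !tnth0 => -[a_neq1 [b_neq1 def_x]].
  by apply: x_irr; exists a, b.
move=> [a [b [a_neq1 b_neq1 def_x]]]; apply: x_irr; exists a, b.
by rewrite !tnthS !tnth0.
Qed.

Lemma basis_irreducible (X : choiceType) (m : free_monoid X) :
  basis m <-> irreducible m.
Proof. exact: (free_basis_irreducible (@basis_free X) m). Qed.

Lemma primitive_irreducible (X : choiceType) (m : free_monoid X) :
  primitive m <-> irreducible m.
Proof.
split=> [[B [freeB Bm]] | irr_m]; first exact/(free_basis_irreducible freeB).
by exists (@basis X); split; [exact: basis_free | apply/basis_irreducible].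
Qed.

Lemma free_basis_tuple_irreducible (X : finType)
    (t : #|X|.-tuple (free_monoid X)) :
  free_basis_tuple t <-> uniq t /\ forall i, irreducible (tnth t i).
Proof.
split=> -[t_uniq]; first move=> free_t; last move=> irr_t; split=> //.
  by move=> i; apply/(free_basis_irreducible free_t)/mem_tnth.
have t_letters : {subset t <= map (@letter X) (enum X)}.
  move=> _ /tnthP[i ->]; have [x ->] := (basis_irreducible _).2 (irr_t i).
  by apply: map_f; rewrite mem_enum.
(* Counting: [t] has no repetition and is as long as the list of all letters that contains it, so
   both have the same elements. *)
have [|_ t_eq] := uniq_min_size t_uniq t_letters.
  by rewrite size_map -cardE size_tuple.
apply: free_basis_ext (@basis_free X) => m; rewrite t_eq; split.
  by move=> [x ->]; apply: map_f; rewrite mem_enum.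
by move=> /mapP[x _ ->]; exists x.
Qed.

Theorem mainTheorem8 (X : finType) (hX : 2 <= #|X|) :
  [/\ forall m : free_monoid X, basis m <-> irreducible m,
      definable1 (@basis X),
      definable1 (@primitive (free_monoid X)) &
      definable (@free_basis_tuple (free_monoid X) #|X|)].
Proof.
have def_irr := @definable_irreducible (free_monoid X).
split; first exact: basis_irreducible.
(* [thead v] unfolds to [tnth v ord0], so the formula for irreducibility is used at the only
   variable in scope. *)
- by apply: definable_iff (def_irr 1 ord0) => v; apply: basis_irreducible.
- by apply: definable_iff (def_irr 1 ord0) => v; apply: primitive_irreducible.
apply: definable_iff (@free_basis_tuple_irreducible X) _.
apply: definable_and; first exact: definable_uniq.
exact: definable_forall (def_irr _).
Qed.
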